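(* Every strongly Baire topological space $X$ is a Namioka space.
   Context: For a subset $C$ of a topological space, ${\rm int}(C)$ denotes its interior and $\overline{C}$ its closure. A transfinite net $(A_\xi:\xi<\alpha)$ of sets indexed by the ordinals below $\alpha$ is increasing if $A_\xi\subseteq A_\eta$ whenever $\xi\le\eta<\alpha$. Let $\alpha$ be an ordinal. A net $(B_\xi:\xi<\alpha)$ of sets occupies a net $(A_\xi:\xi<\alpha)$ of sets if (i) $A_\xi\subseteq B_\xi$ for every $\xi<\alpha$; and (ii) $A_\beta\subseteq\bigcup_{\xi<\beta}B_\xi$ for every (nonzero) limit ordinal $\beta<\alpha$. A topological space $X$ is strongly Baire if for every ordinal $\alpha$, every increasing net $(A_\xi:\xi<\alpha)$ of closed subsets of $X$ and every increasing net $(B_\xi:\xi<\alpha)$ of closed subsets of $X$ which occupies $(A_\xi:\xi<\alpha)$, one has ${\rm int}\big(\bigcup_{\xi<\alpha}A_\xi\big)\subseteq\overline{\bigcup_{\xi<\alpha}{\rm int}(B_\xi)}$. A function $f:X\times Y\to\mathbb R$ is separately continuous if it is continuous with respect to each variable when the other is fixed. A function $f:X\times Y\to\mathbb R$ has the Namioka property if there exists a dense $G_\delta$-set $A\subseteq X$ such that $f$ is (jointly) continuous at every point of $A\times Y$. A Namioka space is a Baire space $X$ such that for every compact space $Y$ every separately continuous function $f:X\times Y\to\mathbb R$ has the Namioka property. *)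

(* Defs.v *)
From HB Require Import structures.
From mathcomp Require Import all_boot all_order all_algebra.
From mathcomp Require Import all_classical all_reals all_analysis.
From mathcomp Require Import borel_hierarchy.

Set Implicit Arguments.
Unset Strict Implicit.
Unset Printing Implicit Defensive.

Import numFieldNormedType.Exports.

Local Open Scope classical_set_scope.
Local Open Scope order_scope.

(* A transfinite net (A_xi : xi < alpha) is a family A : W -> set X indexed by
   a well-ordered type W of order type alpha; the elements of W play the role
   of the ordinals xi < alpha. W may be empty (alpha = 0). *)

Section Nets.
Context {d : Order.disp_t} {W : orderType d} {X : Type}.

Definition is_limit (b : W) : Prop :=
  (exists a, a < b) /\ (forall a, a < b -> exists2 c, a < c & c < b).

Definition increasing_net (A : W -> set X) : Prop :=
  forall i j : W, i <= j -> A i `<=` A j.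

Definition occupies (B A : W -> set X) : Prop :=
  (forall i, A i `<=` B i) /\
  (forall b, is_limit b -> A b `<=` \bigcup_(i in [set i | i < b]) B i).

End Nets.

Definition strongly_baire (X : topologicalType) : Prop :=
  forall (d : Order.disp_t) (W : orderType d),
    well_founded (fun i j : W => i < j) ->
  forall A B : W -> set X,
    (forall i, closed (A i)) -> increasing_net A ->
    (forall i, closed (B i)) -> increasing_net B ->
    occupies B A ->
    interior (\bigcup_i A i) `<=` closure (\bigcup_i interior (B i)).

Definition baire_space (X : topologicalType) : Prop :=
  forall U : nat -> set X,
    (forall n, open (U n)) -> (forall n, dense (U n)) -> dense (\bigcap_n U n).

Definition separately_continuous {X Y Z : topologicalType} (f : X * Y -> Z) :
    Prop :=
  (forall x, continuous (fun y => f (x, y))) /\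
  (forall y, continuous (fun x => f (x, y))).

Definition namioka_property {X Y Z : topologicalType} (f : X * Y -> Z) : Prop :=
  exists A : set X, [/\ dense A, Gdelta A &
    forall x y, A x -> {for (x, y), continuous f}].

(* Compactness does not include the Hausdorff axiom. *)
Definition namioka_space (R : realType) (X : topologicalType) : Prop :=
  baire_space X /\
  forall Y : topologicalType, compact [set: Y] ->
  forall f : X * Y -> R, separately_continuous f -> namioka_property f.

(* Main.v *)
(* Call x determined by S up to (d, e) when |f(z,y) - f(z,y')| <= d for all z in
   S implies |f(x,y) - f(x,y')| <= e. The set of such x is closed, and by
   compactness of Y x Y, if S is the union of a chain S_i, then a point determined
   by S up to (0, e) is determined by some S_i up to (0, e'), for any e' > e.
   Well-order X and take the least initial segment P such that, for some finite F
   and some e < eps, P u F determines up to (0, e) every point of a nonempty open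
   subset of V. If P had a maximum, it could be moved to F; if P were nonempty
   without maximum, the strong Baire property, applied to the sets determined by
   the proper initial segments of P, would give a smaller one (compactness is
   exactly what makes the second net occupy the first). So P is empty, and the
   finite set F suffices. A countable Baire argument then replaces (0, e) by
   (1/n, e'), and total boundedness of Y for the functions f(z, _), z in F, yields
   a nonempty open subset of V on which x |-> f(x, _) varies little in the sup
   norm. Intersecting the resulting dense open sets gives the dense G_delta. *)
From HB Require Import structures.
Require Import Defs.
From Stdlib Require Wellfounded.
From mathcomp Require Import all_boot all_order all_algebra.
From mathcomp Require Import all_classical all_reals all_analysis.
From mathcomp Require Import borel_hierarchy wochoice.
From mathcomp Require Import lra.

Set Implicit Arguments.
Unset Strict Implicit.
Unset Printing Implicit Defensive.

Import Order.TTheory GRing.Theory Num.Theory.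
Import numFieldNormedType.Exports.

Local Open Scope classical_set_scope.

(** * Well-ordering of an arbitrary type and its initial segments *)

Definition well_ordered (X : choiceType) : Type := X.

Section WellOrdered.
Local Open Scope order_scope.
Variable X : choiceType.
Local Notation T := (well_ordered X).

HB.instance Definition _ := Choice.on T.

Let le : rel T := sval (well_ordering_principle X).

Let le_well : well_order le.
Proof. exact: (svalP (well_ordering_principle X)). Qed.

Let chain_le : wo_chain le predT.
Proof. by move=> A _ /le_well. Qed.

Let le_refl : reflexive le.
Proof. by move=> x; apply: (wo_chain_reflexive chain_le). Qed.

Let le_anti : antisymmetric le.
Proof. by move=> x y; apply: (wo_chain_antisymmetric chain_le). Qed.

Let le_total : total le.
Proof. by move=> x y; apply: (wo_chainW chain_le). Qed.

Let le_trans : transitive le.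
Proof.
move=> y x z lexy leyz.
(* [w] is the least of the three points; if it is [y] or [z], antisymmetry identifies two of
   them. *)
have [|w [[wxyz minw] _]] := @le_well [pred t | [|| t == x, t == y | t == z]].
  by exists x; rewrite inE eqxx.
have {}minw t : t \in [:: x; y; z] -> le w t.
  by rewrite !inE => txyz; apply: minw.
move: wxyz; rewrite inE => /or3P[] /eqP ew; subst w.
- by apply: minw; rewrite !inE eqxx !orbT.
- have lexx := minw x; rewrite !inE eqxx /= in lexx.
  by rewrite (@le_anti x y) // lexy lexx.
- have leyy := minw y; rewrite !inE eqxx orbT /= in leyy.
  by rewrite -(@le_anti y z) // leyz leyy.
Qed.

HB.instance Definition _ := Order.Le_isPOrder.Build Order.default_display T
  le_refl le_anti le_trans.

HB.instance Definition _ := Order.POrder_isTotal.Build Order.default_display T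
  le_total.

Lemma well_ordered_min (A : set T) :
  A !=set0 -> exists2 m, A m & forall a, A a -> m <= a.
Proof.
move=> [a Aa]; have [|m [[/asboolP Am minm] _]] := @le_well [pred t | `[< A t >]].
  by exists a; apply/asboolP.
by exists m => // b Ab; apply/minm/asboolP.
Qed.

Lemma well_ordered_wf : well_founded (fun i j : T => i < j).
Proof.
move=> i; apply: contrapT => nAcc_i.
have [|m nAcc_m minm] := @well_ordered_min
  [set j | ~ Acc (fun i j : T => i < j) j]; first by exists i.
apply: nAcc_m; constructor=> j ltjm; apply: contrapT => /minm lemj.
by have := lt_le_trans ltjm lemj; rewrite ltxx.
Qed.

Variable S : {pred T}.

Definition initial_segment : Type := {x : T | x \in S}.

HB.instance Definition _ := SubType.on initial_segment.
HB.instance Definition _ := Choice.on initial_segment.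
HB.instance Definition _ :=
  [SubChoice_isSubOrder of initial_segment by <: with Order.default_display].

End WellOrdered.

Local Open Scope ring_scope.

(** * Consequences of the strong Baire property *)

Section StronglyBaire.
Variable X : topologicalType.
Hypothesis hX : strongly_baire X.

Lemma strongly_baire_meet (d : Order.disp_t) (W : orderType d)
    (A B : W -> set X) (U : set X) :
  well_founded (fun i j : W => (i < j)%O) ->
  (forall i, closed (A i)) -> increasing_net A ->
  (forall i, closed (B i)) -> increasing_net B -> occupies B A ->
  open U -> U !=set0 -> U `<=` \bigcup_i A i ->
  exists i, (U `&` interior (B i)) !=set0.
Proof.
move=> wfW cA iA cB iB oBA oU [x Ux] UA.
have intx : interior (\bigcup_i A i) x.
  by apply: (interiorS UA); rewrite (interior_id U).1.
have [y [[i _ Biy] Uy]] :=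
  hX wfW cA iA cB iB oBA intx (open_nbhs_nbhs (conj oU Ux)).
by exists i, y.
Qed.

(** The order on [nat] has no limit elements, so an increasing sequence occupies itself and serves
    as both nets. *)
Lemma strongly_baire_seq (C : nat -> set X) (U : set X) :
  (forall n, closed (C n)) -> (forall m n, (m <= n)%N -> C m `<=` C n) ->
  open U -> U !=set0 -> U `<=` \bigcup_n C n ->
  exists n, (U `&` interior (C n)) !=set0.
Proof.
move=> cC iC; apply: (strongly_baire_meet _ cC iC cC iC).
- elim=> [|n IHn]; constructor=> m; first by rewrite ltEnat.
  by rewrite ltEnat /= ltnS leq_eqVlt => /predU1P[->//|]; case: IHn => IHn /IHn.
- split=> [i x //|] -[|n] [[m ltm] lim]; first by rewrite ltEnat in ltm.
  have [|p] := lim n; first by rewrite ltEnat /=.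
  by rewrite !ltEnat /= => ltnp; rewrite ltnS leqNgt ltnp.
Qed.

Lemma strongly_baire_baire : baire_space X.
Proof.
move=> U oU dU V V0 oV; apply: contrapT => VU.
(* Finite intersections make the complements increasing. If [V] misses the full intersection, these
   complements cover it, and one of them has interior, against the density of [D n]. *)
pose D n := \big[setI/setT]_(i < n) U i.
have oD n : open (D n).
  rewrite /D; elim/big_ind: _ => //; first exact: openT.
  exact: openI.
have dD n : dense (D n).
  elim: n => [|n IHn]; rewrite /D.
    by rewrite big_ord0 => A A0 _; rewrite setIT.
  by rewrite big_ord_recr /=; exact: (denseI (oD n) IHn (dU n)).
have [|||||n [x [Vx intx]]] := @strongly_baire_seq (fun n => ~` D n) V.
- by move=> n; exact: open_closedC.
- move=> m n lemn; apply: subsetC => x; rewrite /D -!bigcap_mkord => Dx i im.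
  by apply: Dx; exact: leq_trans lemn.
- exact: oV.
- exact: V0.
- move=> x Vx; apply: contrapT => nDx; apply: VU; exists x; split=> // n _.
  apply: contrapT => nUx; apply: nDx; exists n.+1 => // Dx; apply: nUx.
  by move: Dx; rewrite /D big_ord_recr => -[].
have [|y [iy Dy]] := dD n (interior (~` D n)) _ (@open_interior _ _).
  by exists x.
exact: (interior_subset iy).
Qed.

End StronglyBaire.

(** * Determined points and the descent along a well-order *)

Section Determined.
Variables (R : realType) (X Y : topologicalType) (f : X * Y -> R).
Hypothesis f_sep : separately_continuous f.
Hypothesis cptY : compact [set: Y].

Definition determined (S : set X) (d e : R) : set X :=
  [set x | forall y y',
    (forall z, S z -> `|f (z, y) - f (z, y')| <= d) ->
    `|f (x, y) - f (x, y')| <= e].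

Lemma sub_determined (S S' : set X) (d d' e e' : R) :
  S `<=` S' -> d' <= d -> e <= e' -> determined S d e `<=` determined S' d' e'.
Proof.
move=> SS' d'd ee' x Sx y y' yy'; apply: le_trans ee'; apply: Sx => z /SS' S'z.
exact: le_trans (yy' _ S'z) d'd.
Qed.

Lemma determined_closed (S : set X) (d e : R) : closed (determined S d e).
Proof.
have [_ fl] := f_sep.
have -> : determined S d e = \bigcap_(q in [set q : Y * Y | forall z, S z ->
    `|f (z, q.1) - f (z, q.2)| <= d])
    ((fun x => `|f (x, q.1) - f (x, q.2)|) @^-1` [set t | t <= e]).
  apply/seteqP; split=> x /= hx; first by move=> q /=; exact: hx.
  by move=> y y' yy'; exact: (hx (y, y')).
apply: closed_bigI => q _; apply: preimage_closed; last exact: closed_le.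
move=> x _; apply: (@continuous_comp _ _ _ (fun x => f (x, q.1) - f (x, q.2))).
  by apply: continuousB; exact: fl.
exact: norm_continuous.
Qed.

Lemma osc_continuous x (q : Y * Y) :
  (fun q : Y * Y => `|f (x, q.1) - f (x, q.2)|) @ q -->
  `|f (x, q.1) - f (x, q.2)|.
Proof.
have [fr _] := f_sep; case: q => y y'.
apply: cvg_norm; apply: cvgB.
- apply: (@cvg_comp _ _ _ fst (fun y => f (x, y)) _ _ _ _ (fr x y)).
  exact: cvg_fst.
- apply: (@cvg_comp _ _ _ snd (fun y => f (x, y)) _ _ _ _ (fr x y')).
  exact: cvg_snd.
Qed.

(** The filter form serves two limits: sets growing to [S] with tolerance 0, and a tolerance tending
    to 0 with [S] fixed. Each pair [q] has a neighbourhood on which the implication eventually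
    holds, and compactness of [Y * Y] makes this uniform. *)
Lemma determined_near (I : Type) (F : set_system I) (S : set X) (S_ : I -> set X)
    (d : I -> R) (e e' : R) x :
  Filter F -> (forall z, S z -> \forall i \near F, S_ i z) ->
  (forall r, 0 < r -> \forall i \near F, d i < r) -> e < e' ->
  determined S 0 e x -> \forall i \near F, determined (S_ i) (d i) e' x.
Proof.
move=> FF SS dF ee' Sx.
have /compact_near_coveringP cptYY : compact ([set: Y] `*` [set: Y]).
  exact: compact_setX.
have near_q : \near F, [set: Y] `*` [set: Y] `<=` (fun i q =>
    (forall z, S_ i z -> `|f (z, q.1) - f (z, q.2)| <= d i) ->
    `|f (x, q.1) - f (x, q.2)| <= e') F.
  apply: cptYY => q _.
  have [lt_e'|le_e'] := ltP `|f (x, q.1) - f (x, q.2)| e'.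
    exists ([set q | `|f (x, q.1) - f (x, q.2)| < e'], setT).
      split=> /=; last exact: filterT.
      exact: cvgr_lt (osc_continuous (x := x) (q := q)) _ lt_e'.
    by move=> -[q' i] [/= /ltW].
  (* Here [x] separates the pair by more than [e], so some [z] in [S] separates it too; half of that
     separation persists near [q] and eventually exceeds [d i]. *)
  have /existsNP[z /not_implyP[Sz /negP]] :
      ~ forall z, S z -> `|f (z, q.1) - f (z, q.2)| <= 0.
    by move=> /Sx; rewrite leNgt (lt_le_trans ee' le_e').
  rewrite -ltNge => zq; pose r := `|f (z, q.1) - f (z, q.2)| / 2.
  have r0 : 0 < r by rewrite divr_gt0.
  exists ([set q | r < `|f (z, q.1) - f (z, q.2)|], [set i | S_ i z /\ d i < r]).
    split=> /=; last by apply: filterI; [exact: SS|exact: dF].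
    apply: cvgr_gt (osc_continuous (x := z) (q := q)) _ _.
    by rewrite /r ltr_pdivrMr// mulr_natr mulr2n ltrDl.
  move=> -[q' i] [/= ltr [Siz ltdr]] /(_ z Siz).
  by rewrite leNgt (lt_trans ltdr ltr).
by apply: filterS near_q => i /= Hi y y'; exact: (Hi (y, y')).
Qed.

Lemma totally_bounded_family (F : seq X) (r : R) : 0 < r ->
  exists s : seq Y, forall y, exists2 y', y' \in s &
    forall z, z \in F -> `|f (z, y) - f (z, y')| < r.
Proof.
move=> r0; have [fr _] := f_sep.
(* Finite lists directed by inclusion: near-covering compactness then collects the centres of a
   finite subcover in one list. *)
pose G := filter_from [set: seq Y] (fun s => [set t : seq Y | {subset s <= t}]).
have FG : Filter G.
  apply: filter_from_filter; first by exists [::].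
  by move=> s t _ _; exists (s ++ t) => // u st; split=> y ys; apply: st;
    rewrite mem_cat ys ?orbT.
have /compact_near_coveringP cov := cptY.
have [|s _ /(_ s)] := cov _ G (fun s y => exists2 y', y' \in s &
    forall z, z \in F -> `|f (z, y) - f (z, y')| < r) FG; last first.
  by move=> H; exists s => y; exact: H.
move=> y _.
exists ([set y' | forall z, z \in F -> `|f (z, y') - f (z, y)| < r],
        [set s | y \in s]).
  split=> /=; last by exists [:: y] => // s; apply; rewrite inE.
  elim: F => [|z F IHF]; first exact: filterE.
  have zF : \forall y' \near y, `|f (z, y') - f (z, y)| < r.
    exact: cvgr_distC_lt _ _ (fr z y) _ r0.
  apply: (filterS2 _ _ IHF zF) => y' Fy' zy' u.
  by rewrite inE => /predU1P[->|/Fy'].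
by move=> [y' s] [/= y'F ys]; exists y.
Qed.

Variable V : set X.
Variable eps : R.

Local Notation T := (well_ordered X).

(** The strict bound [e < eps] leaves room to enlarge [e] whenever [P] shrinks, and [F] may grow to
    absorb a maximum of [P]. *)
Definition essentially_determined (P : set X) : Prop :=
  exists (F : seq X) (U : set X) (e : R),
    [/\ open U, U !=set0, U `<=` V, e < eps &
        U `<=` determined (P `|` [set` F]) 0 e].

Definition segment (w : T) : set X := [set x : X | ((x : T) < w)%O].

Lemma determined_limit (S : set T) (F : set X) (e e' : R) x :
  S !=set0 -> (forall i, S i -> exists2 j, S j & (i < j)%O) -> e < e' ->
  determined (S `|` F) 0 e x ->
  exists2 v, S v & determined (segment v `|` F) 0 e' x.
Proof.
move=> S0 S_nomax ee' SFx.
(* Filter of tails of [S]: without a maximum, each [z] in [S] eventually lies in [segment u]. *)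
pose G := filter_from S (fun v => [set u : T | S u /\ (v <= u)%O]).
have FG : Filter G.
  apply: filter_from_filter => // i j Si Sj.
  have [lij|/ltW lji] := leP i j.
    by exists j => // u [Su ju]; split; split=> //; exact: le_trans ju.
  by exists i => // u [Su iu]; split; split=> //; exact: le_trans iu.
have [|r r0|v Sv] := @determined_near _ G _ (fun u => segment u `|` F)
  (fun=> 0) e e' x FG _ _ ee' SFx.
- move=> z [/S_nomax[j Sj zj]|Fz]; last by apply: filterE => u; right.
  by exists j => // u [_ ju]; left; exact: lt_le_trans ju.
- exact: filterE.
- by move=> /(_ v)vx; exists v => //; exact: vx.
Qed.

Hypothesis hX : strongly_baire X.

Lemma essentially_determined_limit (S : {pred T}) :
  (forall i j, (i <= j)%O -> j \in S -> i \in S) ->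
  (exists i, i \in S) ->
  (forall i, i \in S -> exists2 j, j \in S & (i < j)%O) ->
  essentially_determined [set` S] ->
  exists2 w, w \in S & essentially_determined (segment w).
Proof.
move=> Sdown S0 S_nomax [F [U [e [oU U0 UV elt UF]]]].
(* Each gap pays for one use of [determined_limit]: from [e] to [e1] for the first net to cover [U],
   from [e1] to [e2] for the second to occupy the first. *)
pose e1 := (e + eps) / 2; pose e2 := (e1 + eps) / 2.
have ee1 : e < e1 by rewrite midf_lt.
have e1e : e1 < eps by rewrite midf_lt.
have e1e2 : e1 < e2 by rewrite midf_lt.
have e2e : e2 < eps by rewrite midf_lt.
pose N (r : R) (i : initial_segment S) :=
  determined (segment (val i) `|` [set` F]) 0 r.
have cN r i : closed (N r i) by exact: determined_closed.
have iN r : increasing_net (N r).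
  move=> i j ij; apply: sub_determined => //; apply: setSU => x xi.
  exact: lt_le_trans xi (le_wval i j ij).
have [|||i [x [Ux ix]]] :=
    strongly_baire_meet hX _ (cN e1) (iN e1) (cN e2) (iN e2) _ oU U0.
- by apply: (Inverse_Image.wf_inverse_image _ _ (fun i j : T => (i < j)%O) val);
    exact: well_ordered_wf.
(* Below a limit [b] the segment is nonempty without maximum, which is what [determined_limit]
   requires. *)
- split=> [i|b [[a ab] blim] x bx].
    by apply: sub_determined => //; exact: ltW.
  have [||v vb vx] := @determined_limit [set v | (v < val b)%O] [set` F]
    e1 e2 x _ _ e1e2 bx.
  + by exists (val a).
  + move=> v vb; have vS : v \in S by apply: Sdown (ltW vb) (valP b).
    by have [c vc cb] := blim (Sub v vS) vb; exists (val c).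
  + by exists (Sub v (Sdown _ _ (ltW vb) (valP b))).
- move=> x Ux.
  have [v vS vx] := determined_limit (S := [set` S]) S0 S_nomax ee1 (UF x Ux).
  by exists (Sub v vS).
exists (val i); first exact: valP.
exists F, (U `&` interior (N e2 i)), e2; split=> //.
- by apply: openI => //; exact: open_interior.
- by exists x.
- by move=> z [/UV].
- by move=> z [_ /interior_subset].
Qed.

Lemma essentially_determined_set0 :
  open V -> V !=set0 -> 0 < eps -> essentially_determined set0.
Proof.
move=> oV V0 eps0.
have step (S : {pred T}) :
    (forall i j, (i <= j)%O -> j \in S -> i \in S) -> (exists i, i \in S) ->
    essentially_determined [set` S] ->
    exists2 w, w \in S & essentially_determined (segment w).
  move=> Sdown S0 QS.
  have [S_nomax|] :=
      pselect (forall i, i \in S -> exists2 j, j \in S & (i < j)%O).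
    exact: essentially_determined_limit QS.
  move=> /existsNP[m /not_implyP[mS maxm]]; exists m => //.
  have [F [U [e [oU U0 UV elt UF]]]] := QS.
  exists (m :: F), U, e; split=> // x /UF; apply: sub_determined => // z [zS|zF].
    have [zm|mz|->] := ltgtP (z : T) m; [by left| |by right; rewrite /= inE eqxx].
    by exfalso; apply: maxm; exists z.
  by right; rewrite /= inE orbC (_ : z \in F).
have [x Vx] := V0.
have [|||w _ Qw] := step predT.
- by [].
- by exists x.
(* Start of the descent: the whole space determines each of its own points at level 0. *)
- exists [::], V, 0; split=> // z Vz y y' yy'.
  by apply: yy'; left.
have [m Qm minm] := @well_ordered_min X
  [set i | essentially_determined (segment i)] (ex_intro _ w Qw).
(* A predecessor of [m] would let [step] contradict minimality, so [segment m] is empty. *)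
have [[i im]|segm0] := pselect (exists i : T, (i < m)%O).
  have [|||v vm Qv] := step [pred i | (i < m)%O].
  - by move=> j k jk; rewrite !inE; exact: le_lt_trans.
  - by exists i.
  - exact: Qm.
  by have := le_lt_trans (minm v Qv) vm; rewrite ltxx.
suff <- : segment m = set0 by [].
by apply/seteqP; split=> // z zm; apply: segm0; exists z.
Qed.

End Determined.

(** * Small oscillation on open sets and joint continuity *)

Section Namioka.
Variables (R : realType) (X Y : topologicalType) (f : X * Y -> R).
Hypothesis hX : strongly_baire X.
Hypothesis f_sep : separately_continuous f.
Hypothesis cptY : compact [set: Y].

Definition osc_lt (e : R) (U : set X) : Prop :=
  forall x x' y, U x -> U x' -> `|f (x, y) - f (x', y)| < e.

Lemma osc_lt_nonempty_open (V : set X) (e : R) : open V -> V !=set0 -> 0 < e ->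
  exists U, [/\ open U, U !=set0, U `<=` V & osc_lt e U].
Proof.
(* Points of the final set will be within [3 * r] of a centre [x0], uniformly in [y], hence within
   [6 * r < e] of each other. *)
move=> oV V0 e0; pose r := e / 7; have r0 : 0 < r by rewrite divr_gt0.
have [F [U [e' [oU U0 UV lt_e'r UF]]]] :=
  essentially_determined_set0 f_sep cptY hX oV V0 r0.
rewrite set0U in UF.
(* Total boundedness approximates on [F] only up to a positive error, so tolerance 0 has to become
   positive. *)
pose C n := determined f [set` F] n.+1%:R^-1 r.
have [||x Ux|n [x0 [Ux0 Cx0]]] := @strongly_baire_seq _ hX C U _ _ oU U0.
- by move=> n; exact: determined_closed.
- move=> m n mn; apply: sub_determined => //.
  by rewrite lef_pV2 ?posrE// ler_nat ltnS.
- have [||n _ /(_ n (leqnn n))nx] := @determined_near _ _ _ _ f_sep cptY _ \oo _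
    (fun=> [set` F]) (fun n => n.+1%:R^-1) _ r x _ _ _ lt_e'r (UF x Ux).
  + by move=> z Fz; exact: filterE.
  + by move=> q q0; exact: (near_infty_natSinv_lt (PosNum q0)).
  + by exists n.
have [s sF] := totally_bounded_family f_sep cptY F (r := n.+1%:R^-1) ltac:(by []).
pose D := [set x | forall y, y \in s -> `|f (x, y) - f (x0, y)| < r].
have Dx0 : nbhs x0 D.
  have [_ fl] := f_sep; rewrite /D; elim: s {sF D} => [|y s IHs].
    exact: filterE.
  have yD : \forall x \near x0, `|f (x, y) - f (x0, y)| < r.
    exact: cvgr_distC_lt _ _ (fl y x0) _ r0.
  apply: (filterS2 _ _ IHs yD) => x sx yx u.
  by rewrite inE => /predU1P[->|/sx].
exists (interior (U `&` C n `&` D)); split.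
- exact: open_interior.
- exists x0; apply: filterI => //; apply: filterI => //.
  exact: open_nbhs_nbhs.
- by move=> x /interior_subset[[/UV]].
(* Pass from [(x, y)] to [(x, y')], then [(x0, y')], then [(x0, y)]: the outer moves use [C n] at
   [x] and [x0], the middle one uses [D]. *)
have close x y : (U `&` C n `&` D) x -> `|f (x, y) - f (x0, y)| <= 3 * r.
  move=> [[_ Cx] Dx]; have [y' y's y'F] := sF y.
  have yy' z : [set` F] z -> `|f (z, y) - f (z, y')| <= n.+1%:R^-1.
    by move=> /y'F/ltW.
  have h1 := Cx _ _ yy'; have h2 := interior_subset Cx0 _ _ yy'.
  have h3 := Dx _ y's; move: h1 h2 h3; rewrite !ler_distl !ltr_distl.
  lra.
move=> x x' y /interior_subset/(close _ y) h /interior_subset/(close _ y).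
move: h; rewrite !ler_distl ltr_distl /r; lra.
Qed.

Lemma separately_continuous_namioka : namioka_property f.
Proof.
pose G n := \bigcup_(U in [set U | open U /\ osc_lt n.+1%:R^-1 U]) U.
have oG n : open (G n) by apply: bigcup_open => U [].
exists (\bigcap_n G n); split.
- apply: (strongly_baire_baire hX) => // n V V0 oV.
  have [//|U [oU [x Ux] UV oscU]] :=
    osc_lt_nonempty_open oV V0 (e := n.+1%:R^-1).
  by exists x; split; [exact: UV|exists U].
- by exists G.
move=> x y Gx; have [fr _] := f_sep.
apply/cvgrPdist_lt => e e0.
have e20 : 0 < e / 2 by rewrite divr_gt0.
have [n _ /(_ n (leqnn n)) /= ne] := near_infty_natSinv_lt (PosNum e20).
have [U [oU oscU] Ux] := Gx n I.
(* Compare [(x', y')] with [(x, y')] by the oscillation on [U], then with [(x, y)] by continuity of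
   [f (x, _)]. *)
exists (U, [set y' | `|f (x, y) - f (x, y')| < e / 2]).
  split=> /=; first exact: open_nbhs_nbhs.
  exact: cvgr_dist_lt _ _ (fr x y) _ e20.
move=> [x' y'] [/= Ux' yy']; have := lt_trans (oscU x x' y' Ux Ux') ne.
by move: yy'; rewrite !ltr_distl; lra.
Qed.

End Namioka.

Theorem theorem2p3 (R : realType) (X : topologicalType) (hX : strongly_baire X) :
  namioka_space R X.
Proof.
split; first exact: strongly_baire_baire.
by move=> Y cptY f f_sep; exact: separately_continuous_namioka.
Qed.
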